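(* Let $X$ be a real Banach space with single-valued normalized duality mapping, let $N\ge1$, and let $A_1,\dots,A_N:X\to X$ be accretive operators such that the system $A_i(x)=0$, $i=1,\dots,N$, possesses an exact solution $\widehat{x}^*$. Assume that the $A_i$ are Fréchet differentiable in the closed ball $B_r(\widehat{x}^* )$ with center $\widehat{x}^*$ and radius $r>0$, and that for some constant $K$ $$\|A_i'(x)-A_i'(y)\|\le K\|x-y\|\quad\text{for all }x,y\in B_r(\widehat{x}^* ),\ i=1,\dots,N.$$ Let $\{\alpha_n\}_{n\ge0}$ be a sequence of real numbers with $\alpha_n>0$, $\alpha_n\to0$ and $1\le\frac{\alpha_n}{\alpha_{n+1}}\le\rho$ for all $n$, where $\rho>1$ is a constant. Assume that the points $x_i^0\in B_r(\widehat{x}^* )$ satisfy the componentwise source condition $$x_i^0-\widehat{x}^*=A_i'(\widehat{x}^* )v_i,\qquad v_i\in X,\quad i=1,\dots,N.$$ If $\sum_{i=1}^N\|v_i\|$ is sufficiently small and $x_0$ is close enough to $\widehat{x}^*$ (that is, there is $\varepsilon>0$, independent of the choice of $v_i$, $x_i^0$ and $x_0$, such that the following holds whenever $\sum_{i=1}^N\|v_i\|\le\varepsilon$ and $\|x_0-\widehat{x}^*\|\le\varepsilon$), then the sequence $\{x_n\}$ defined for $n=0,1,2,\dots$ by $$A_i(x_n)+\frac{\alpha_n}{N}(x_n-x_i^0)+\Big(A_i'(x_n)+\frac{\alpha_n}{N}I\Big)(x_n^i-x_n)=0,\quad i=1,\dots,N,\qquad x_{n+1}=\frac1N\sum_{i=1}^N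 x_n^i,$$ satisfies $$\|x_n-\widehat{x}^*\|=O(\alpha_n).$$
   Context: The normalized duality mapping $J:X\to X^*$ satisfies $\langle x,J(x)\rangle=\|x\|^2=\|J(x)\|^2$ for all $x\in X$; it is assumed single valued. An operator $A:X\to X$ is accretive if $\langle A(x)-A(y),J(x-y)\rangle\ge 0$ for all $x,y\in X$. $I$ is the identity operator. $O(\alpha_n)$ means bounded by a constant (independent of $n$) times $\alpha_n$. *)

(* Defs.v *)
From HB Require Import structures.
From mathcomp Require Import all_boot all_order all_algebra.
From mathcomp Require Import all_classical all_reals all_analysis.

Set Implicit Arguments.
Unset Strict Implicit.
Unset Printing Implicit Defensive.

Import Order.TTheory GRing.Theory Num.Theory.
Import numFieldNormedType.Exports.

Local Open Scope classical_set_scope.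
Local Open Scope ring_scope.

(* This is a real [sup], so it is the operator norm only for bounded (that is,
   continuous) linear [f]; below it is applied only to such maps. *)
Definition opnorm (R : realType) (X W : normedModType R) (f : X -> W) : R :=
  sup [set `|f h| | h in [set h : X | `|h| <= 1]].

(* The (a priori set-valued) normalized duality mapping, an element of the dual
   space being a continuous element of [{linear X -> R^o}]. *)
Definition duality_map (R : realType) (X : normedModType R) (x : X) :
    set {linear X -> R^o} :=
  [set f | [/\ continuous f, f x = `|x| ^+ 2 & opnorm f ^+ 2 = `|x| ^+ 2]].

Definition accretive (R : realType) (X : normedModType R)
    (J : X -> {linear X -> R^o}) (A : X -> X) : Prop :=
  forall x y : X, 0 <= J (x - y) (A x - A y).

(* [x n] are the outer iterates and [y n i] is the component $x_n^i$.  Since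
   ['d f x] is an unspecified linear map where [f] is not differentiable,
   differentiability at the iterates is part of the definition. *)
Definition regularized_newton_iteration (R : realType) (X : normedModType R)
    (N : nat) (A : 'I_N -> X -> X) (alpha : nat -> R) (xi0 : 'I_N -> X)
    (x0 : X) (x : nat -> X) (y : nat -> 'I_N -> X) : Prop :=
  x 0%N = x0 /\
  forall n : nat,
    [/\ forall i : 'I_N, differentiable (A i) (x n),
        forall i : 'I_N,
          A i (x n) + (alpha n / N%:R) *: (x n - xi0 i)
          + ('d (A i) (x n) (y n i - x n)
             + (alpha n / N%:R) *: (y n i - x n)) = 0
      & x n.+1 = N%:R^-1 *: \sum_(i < N) y n i].

(* Main.v *)
Require Import Defs.
From HB Require Import structures.
From mathcomp Require Import all_boot all_order all_algebra.
From mathcomp Require Import all_classical all_reals all_analysis.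
From mathcomp Require Import ring lra.

Set Implicit Arguments.
Unset Strict Implicit.
Unset Printing Implicit Defensive.

Import Order.TTheory GRing.Theory Num.Theory.
Import numFieldNormedType.Exports.

Local Open Scope classical_set_scope.
Local Open Scope ring_scope.

(** Single-valuedness of the duality mapping makes it positively homogeneous, so
    the accretivity inequality passes to difference quotients and then to the
    limit: each derivative [T = 'd (A i) x] satisfies [0 <= J h (T h)]
    ([accretive_diff]). Testing against [J h] gives
    [a * `|h| <= `|T h + a *: h|] for [a > 0] ([resolvent_ge]), and the
    continuity method upgrades this bound to bijectivity of [T + a]
    ([resolvent_surjective]). Hence each Newton equation at a point of the ball
    has exactly one solution, with the inverse bounded by [1 / a].

    The rate is an induction keeping [`|x n - xhat| <= M * alpha n]. With
    [b = alpha n / N], the equation solved by the new error [p] of a component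
    has the first order Taylor remainder and [b *: S v] on its right-hand side,
    [S] being the derivative at the solution. The remainder is quadratic in the
    old error by the mean value inequality ([norm_taylor1_le], also obtained by
    testing against [J]). In the other term [S] may be replaced by [T] up to the
    Lipschitz bound, and [b *: T v] is almost in the range of [T + b] with
    preimage [b *: v]; this gives an error of order [b * `|v|] and not just
    [`|S v|] ([newton_step_le]). After averaging, the scaled error
    [g = `|x n - xhat| / alpha n] obeys an inequality
    [g' <= rho * (N L g ^ 2 + L s g + 2 s)], where [s] bounds the sum of the
    norms of the [v i], and an interval [[0, M]] with [M] small is mapped to
    itself when [s] is small compared to [M] ([rate_step]). Since [alpha] is
    nonincreasing, a small [M] also keeps the iterates in the ball. *)

(** * Operator norms and derivatives *)

(** Boundedness of [f] is what makes the supremum defining [opnorm f] an actual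
    upper bound. *)
Lemma norm_le_opnorm (R : realType) (X W : normedModType R)
    (f : {linear X -> W}) : continuous f ->
  forall h, `|f h| <= opnorm f * `|h|.
Proof.
move=> fc; have [c c0 fle] : exists2 c : R,
    0 < c & forall h, `|f h| <= c * `|h|.
  have /linear_boundedP fb : bounded_near f (nbhs 0).
    by apply: continuous_linear_bounded; exact: fc.
  near (pinfty_nbhs R) => c; exists c; last by near: c.
  by near: c; exact: nbhs_pinfty_gt.
have unit_le h : `|h| <= 1 -> `|f h| <= opnorm f.
  move=> h1; apply: ub_le_sup; last by exists h.
  exists c => _ [k k1 <-]; apply: le_trans (fle k) _.
  by rewrite ler_piMr// ltW.
move=> h; have [->|h0] := eqVneq h 0; first by rewrite linear0 !normr0 mulr0.
have nh : 0 < `|h| by rewrite normr_gt0.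
rewrite -ler_pdivrMr//.
have := unit_le (`|h|^-1 *: h).
rewrite linearZ !normrZ normfV normr_id mulVf ?gt_eqF// lexx mulrC.
exact.
Unshelve. all: by end_near. Qed.

Lemma opnorm_eq (R : realType) (X W : normedModType R)
    (f : {linear X -> W}) (c : R) (x : X) : continuous f ->
  (forall h, `|f h| <= c * `|h|) -> x != 0 -> `|f x| = c * `|x| -> opnorm f = c.
Proof.
move=> fc fle x0 fx; apply/eqP; rewrite eq_le; apply/andP; split.
  have c0 : 0 <= c.
    by rewrite -(pmulr_lge0 _ (_ : 0 < `|x|)) ?normr_gt0// -fx.
  apply: ge_sup; first by exists `|f 0|, 0 => //=; rewrite normr0.
  by move=> _ [h h1 <-]; apply: le_trans (fle h) _; rewrite ler_piMr.
by rewrite -(ler_pM2r (_ : 0 < `|x|)) ?normr_gt0// -fx norm_le_opnorm.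
Qed.

Lemma mem_closed_ball (R : realType) (X : normedModType R) (c x : X) (r : R) :
  0 < r -> closed_ball c r x <-> `|x - c| <= r.
Proof. by move=> r0; rewrite closed_ballE// /closed_ball_ /= distrC. Qed.

Lemma diff_lipschitz (R : realType) (X Y : normedModType R) (A : X -> Y)
    (x y h : X) (c : R) :
  differentiable A x -> differentiable A y ->
  opnorm (fun k : X => 'd A x k - 'd A y k) <= c ->
  `|'d A x h - 'd A y h| <= c * `|h|.
Proof.
move=> dx dy opn.
have dc : continuous ('d A x \- 'd A y).
  by move=> z; apply: cvgB; exact: diff_continuous.
apply: le_trans (norm_le_opnorm dc h) _.
by rewrite ler_wpM2r.
Qed.

Lemma cvg_diff_quotient (R : realType) (X Y : normedModType R) (A : X -> Y)
    (p e : X) : differentiable A p ->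
  h^-1 *: (A (h *: e + p) - A p) @[h --> 0^'] --> ('d A p e : Y).
Proof. by move=> dA; rewrite -deriveE//; exact: diff_derivable. Qed.

Lemma is_derive_along (R : realType) (X Y : normedModType R) (A : X -> Y)
    (l : {linear Y -> R^o}) (p e : X) (t : R) : continuous l ->
  differentiable A (t *: e + p) ->
  is_derive t (1 : R) (fun s : R => l (A (s *: e + p)) : R)
    (l ('d A (t *: e + p) e)).
Proof.
move=> lc dA.
pose g (s : R) : R := l (A (s *: e + p)).
have quot : h^-1 *: ((g \o shift t) (h *: 1) - g t) @[h --> 0^'] -->
    (l ('d A (t *: e + p) e) : R).
  have -> : (fun h : R => h^-1 *: ((g \o shift t) (h *: 1) - g t)) =
      l \o (fun h : R => h^-1 *: (A (h *: e + (t *: e + p)) - A (t *: e + p))).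
    apply/funext => h; rewrite /g /= linearZ (raddfB l) /=.
    by rewrite [h%:A]mulr1 scalerDl addrA.
  exact: cvg_comp (@cvg_diff_quotient _ _ _ A _ e dA) (lc _).
apply: DeriveDef; first exact: cvgP quot.
by apply: cvg_lim.
Qed.

(** * The duality mapping and accretive operators *)

Section duality.
Context {R : realType} {X : normedModType R} (J : X -> {linear X -> R^o}).
Hypothesis hJ : forall x : X, duality_map x = [set J x].

Let J_in x : duality_map x (J x). Proof. by rewrite hJ. Qed.

Lemma duality_continuous x : continuous (J x).
Proof. by have [] := J_in x. Qed.

Lemma duality_self x : J x x = `|x| ^+ 2.
Proof. by have [] := J_in x. Qed.

Lemma duality_le x h : `|J x h| <= `|x| * `|h|.
Proof.
have [Jc _ /eqP] := J_in x.
rewrite -real_normK ?num_real// eqrXn2// => /eqP opnE.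
rewrite -opnE; apply: le_trans (norm_le_opnorm Jc h) _.
by rewrite ler_wpM2r// ler_norm.
Qed.

(** [t \*: J x] satisfies the three conditions defining [duality_map (t *: x)],
    so single-valuedness forces it to be [J (t *: x)]. *)
Lemma dualityZ (t : R) x h : 0 < t -> J (t *: x) h = t * J x h.
Proof.
move=> t0.
have tJ : duality_map (t *: x) (t \*: J x).
  have tc : continuous (t \*: J x).
    by move=> z; apply: cvgZr; exact: duality_continuous.
  have tle k : `|(t \*: J x) k| <= `|t *: x| * `|k|.
    rewrite /= normrM normrZ -mulrA ler_wpM2l//; exact: duality_le.
  have tx : (t \*: J x) (t *: x) = `|t *: x| ^+ 2.
    rewrite /= linearZ /= duality_self normrZ gtr0_norm// exprMn.
    by rewrite /GRing.scale /= mulrA -expr2.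
  split=> //.
  (* [opnorm_eq] needs a nonzero vector; at [0] the functional vanishes. *)
  have [x0|x0] := eqVneq (t *: x) 0.
    rewrite x0 normr0 /opnorm; congr (_ ^+ 2).
    have -> : [set `|(t \*: J x) k| | k in [set k : X | `|k| <= 1]] = [set 0].
      apply/seteqP; split=> [_ [k _ <-]|_ ->] /=.
        apply/le_anti; rewrite normr_ge0 andbT.
        by apply: le_trans (tle k) _; rewrite x0 normr0 mul0r.
      by exists 0; rewrite ?linear0 ?normr0//=.
    by rewrite sup1.
  rewrite (@opnorm_eq _ _ _ _ `|t *: x| (t *: x))//.
  rewrite -expr2 -[RHS]ger0_norm ?sqr_ge0//; congr `|_|; exact: tx.
by move: tJ; rewrite hJ => <-.
Qed.

(** Accretivity of [A] between [t *: h + x] and [x], divided by [t ^+ 2] with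
    the help of [dualityZ], is the claim for the difference quotient; let [t]
    tend to [0] from the right. *)
Lemma accretive_diff (A : X -> X) (x h : X) : accretive J A ->
  differentiable A x -> 0 <= J h ('d A x h).
Proof.
move=> accA dA.
have lim : J h (t^-1 *: (A (t *: h + x) - A x)) @[t --> 0^'+] -->
    (J h ('d A x h) : R).
  apply: cvg_dnbhs_at_right.
  apply: (@cvg_comp _ _ _ (fun t : R => t^-1 *: (A (t *: h + x) - A x)) (J h));
    first exact: cvg_diff_quotient.
  exact: duality_continuous.
rewrite -(cvg_lim _ lim)//; apply: limr_ge; first exact: cvgP lim.
near=> t.
have t0 : 0 < t by [].
have := accA (t *: h + x) x.
rewrite addrK dualityZ// pmulr_rge0// linearZ /= => Jge0.
by apply: mulr_ge0 => //; rewrite invr_ge0 ltW.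
Unshelve. all: by end_near. Qed.

(** The remainder [w] is a vector, so the real mean value theorem is applied to
    its image under the functional [J w], which recovers [`|w| ^+ 2] at [w]
    itself and has norm [`|w|]. *)
Lemma norm_taylor1_le (A : X -> X) (z e : X) (L : R) : 0 <= L ->
  (forall t : R, 0 <= t <= 1 -> differentiable A (t *: e + z)) ->
  (forall t : R, 0 <= t <= 1 ->
    `|'d A (t *: e + z) e - 'd A (e + z) e| <= L * `|e| ^+ 2) ->
  `|A (e + z) - A z - 'd A (e + z) e| <= L * `|e| ^+ 2.
Proof.
move=> L0 dA dL; set w := A (e + z) - _ - _.
have [->|w0] := eqVneq w 0; first by rewrite normr0 mulr_ge0.
have nw : 0 < `|w| by rewrite normr_gt0.
pose g (t : R) : R := J w (A (t *: e + z)) - (J w ('d A (e + z) e) : R) *: t.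
have dg (t : R) : 0 <= t <= 1 ->
    is_derive t (1 : R) g (J w ('d A (t *: e + z) e) - J w ('d A (e + z) e)).
  move=> t01.
  have d1 := is_derive_along (@duality_continuous w) (dA _ t01).
  have d2 : is_derive t 1 (J w ('d A (e + z) e) \*: (id : R -> R))
      (J w ('d A (e + z) e)).
    rewrite -[X in is_derive _ _ _ X]mulr1.
    exact: (@is_deriveZ R R R id (J w ('d A (e + z) e) : R) t 1 1).
  exact: is_deriveB d1 d2.
have : {within `[0, 1], continuous g}.
  apply: derivable_within_continuous => s; rewrite in_itv /= => s01.
  by apply: ex_derive; exact: dg.
have dg_itv (s : R) : s \in `]0, 1[ -> is_derive s 1 g
    (J w ('d A (s *: e + z) e) - J w ('d A (e + z) e)).
  by rewrite in_itv /= => /andP[s0 s1]; apply: dg; rewrite !ltW.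
move/(MVT_segment ler01 dg_itv) => [s].
rewrite in_itv /= => s01.
have -> : g 1 - g 0 = J w w.
  have gE t : g t = J w (A (t *: e + z)) - J w ('d A (e + z) e) * t by [].
  rewrite !gE scale1r scale0r add0r mulr0 subr0 mulr1 [in RHS]/w.
  by rewrite !(raddfB (J w)) /= addrAC.
rewrite subr0 mulr1 duality_self => Jw.
have : `|w| ^+ 2 <= `|w| * (L * `|e| ^+ 2).
  rewrite Jw -(raddfB (J w)); apply: le_trans (ler_norm _) _.
  apply: le_trans (duality_le _ _) _.
  by rewrite ler_wpM2l// dL.
by rewrite expr2 ler_pM2l.
Qed.

(** Test [T h + a *: h] against [J h]: accretivity discards the first term and
    the second contributes [a * `|h| ^+ 2]. *)
Lemma resolvent_ge (T : X -> X) (a : R) (h : X) :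
  0 <= J h (T h) -> a * `|h| <= `|T h + a *: h|.
Proof.
move=> JT; have [->|h0] := eqVneq h 0; first by rewrite normr0 mulr0.
rewrite -(ler_pM2l (_ : 0 < `|h|)) ?normr_gt0//.
apply: le_trans (duality_le h _); apply: le_trans (ler_norm _).
rewrite linearD linearZ /= duality_self mulrCA -expr2.
by rewrite lerDr.
Qed.
End duality.

(** * Bijectivity of accretive operators shifted by a positive scalar *)

Lemma fixpoint_exists (R : realType) (X : completeNormedModType R)
    (f : X -> X) (q : R) : 0 <= q < 1 ->
  (forall x y, `|f x - f y| <= q * `|x - y|) -> exists p, f p = p.
Proof.
move=> /andP[q0 q1] fq.
have ctr : is_contraction [fun of totalfun f].
  by exists (NngNum q0); split => //= -[x y] _ /=; exact: fq.
have [] := banach_fixed_point ctr; [exact: closedT|by exists 0|].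
by move=> p _ pE; exists p.
Qed.

Section resolvent_surjective.
Context {R : realType} {X : completeNormedModType R}.
Variable T : {linear X -> X}.
Hypothesis Tc : continuous T.
Hypothesis Tge : forall a h, 0 < a -> a * `|h| <= `|T h + a *: h|.

Let surj (a : R) := forall y, exists h, T h + a *: h = y.

(** When [a] exceeds the norm of [T], the map [h |-> a^-1 *: (y - T h)] is a
    contraction. *)
Let surj_large : exists2 c : R, 0 < c & forall a, c < a -> surj a.
Proof.
exists (`|opnorm T| + 1) => [|a ca y]; first by rewrite ltr_wpDl.
have a0 : 0 < a by apply: lt_trans ca; rewrite ltr_wpDl.
have [|h u|h hE] := @fixpoint_exists _ _ (fun h => a^-1 *: (y - T h))
    (a^-1 * `|opnorm T|).
- rewrite mulr_ge0 ?invr_ge0 ?(ltW a0)//= mulrC ltr_pdivrMr// mul1r.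
  by apply: lt_trans ca; rewrite ltrDl.
- rewrite -scalerBr opprB addrC addrA subrK -linearB normrZ normfV gtr0_norm//.
  rewrite -mulrA ler_wpM2l ?invr_ge0 ?(ltW a0)//.
  rewrite distrC.
  apply: le_trans (norm_le_opnorm Tc _) _.
  by rewrite ler_wpM2r// ler_norm.
exists h; rewrite -[in a *: h]hE scalerA mulfV ?gt_eqF// scale1r.
by rewrite addrC subrK.
Qed.

(** The lower bound makes the inverse [S] of [T + 2 * a] Lipschitz of constant
    [(2 * a)^-1], so that [h |-> S (y + a *: h)], whose fixed points solve the
    equation for [a], is a contraction of ratio [1 / 2]. *)
Let surj_half (a : R) : 0 < a -> surj (2 * a) -> surj a.
Proof.
move=> a0 /choice[S SE] y.
have S_lip u w : `|S u - S w| <= (2 * a)^-1 * `|u - w|.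
  rewrite ler_pdivlMl ?mulr_gt0//.
  have := @Tge (2 * a) (S u - S w); rewrite mulr_gt0// => /(_ isT).
  rewrite linearB scalerBr addrACA -opprD !SE.
  exact.
have [||h hE] := @fixpoint_exists _ _ (fun h => S (y + a *: h)) 2^-1.
- by rewrite invr_ge0 ler0n invf_lt1 ?ltr1n.
- move=> h k; apply: le_trans (S_lip _ _) _.
  rewrite opprD addrACA subrr add0r -scalerBr normrZ gtr0_norm// mulrA.
  by rewrite invfM mulfVK// gt_eqF.
exists h; have := SE (y + a *: h); rewrite hE => /eqP.
by rewrite mulr_natl mulr2n scalerDl addrA (inj_eq (addIr _)) => /eqP.
Qed.

(** Continuity method: start above the norm of [T] and halve down to [a]. The
    uniform bound [Tge] keeps the contraction ratio the same at each step. *)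
Lemma resolvent_surjective (a : R) (y : X) : 0 < a ->
  exists h, T h + a *: h = y.
Proof.
move=> a0; have [c c0 c_surj] := surj_large.
have [k ck] : exists k, c < 2 ^+ k * a.
  exists (Num.bound (c / a)); rewrite -ltr_pdivrMr//.
  apply: lt_trans (archi_boundP _) _; first by rewrite divr_ge0 ?ltW.
  by rewrite -natrX ltr_nat ltn_expl.
suff /(_ y) : surj a by [].
elim: k a a0 ck => [|k IH] a a0 ck.
  by apply: c_surj; rewrite expr0 mul1r in ck.
apply: surj_half => //; apply: IH; first by rewrite mulr_gt0.
by rewrite mulrA -exprSr.
Qed.
End resolvent_surjective.

(** * Error estimates for one Newton step *)

(** One component of one step: [e] and [p] are the errors before and after, [T]
    and [S] the derivatives at the iterate and at the solution, so that [S v] is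
    the error of the reference point. Writing
    [b *: S v = b *: (T v + b *: v) + b *: (S v - T v) - b ^+ 2 *: v] turns the
    source term into a shift of [p] by [b *: v], of size [O(b)], plus terms
    which stay small after division by [b]; without the source condition only
    a bound independent of [b] would survive that division. *)
Lemma newton_step_le (R : realType) (X : normedModType R)
    (T S : {linear X -> X}) (b L : R) (e Ax v p : X) :
  0 < b -> (forall h, b * `|h| <= `|T h + b *: h|) ->
  `|Ax - T e| <= L * `|e| ^+ 2 ->
  `|S v - T v| <= L * `|e| * `|v| ->
  Ax + b *: (e - S v) + (T (p - e) + b *: (p - e)) = 0 ->
  b * `|p| <= L * `|e| ^+ 2 + b * (L * `|e| * `|v|) + 2 * b ^+ 2 * `|v|.
Proof.
move=> b0 Tge taylor lip eqp.
have resp : T p + b *: p = - (Ax - T e) + b *: S v.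
  have -> : T p + b *: p = T (p - e) + b *: (p - e) + (T e + b *: e).
    by rewrite linearB scalerBr addrACA !subrK.
  rewrite -(addr0_eq eqp) opprD addrACA scalerBr opprB subrK.
  by rewrite [in RHS]opprB [- _ + _]addrC.
have res : T (p - b *: v) + b *: (p - b *: v)
    = - (Ax - T e) + b *: (S v - T v) - b ^+ 2 *: v.
  rewrite linearB linearZ /= !scalerBr scalerA -expr2 addrACA resp.
  by rewrite -opprD -!addrA opprD.
have := Tge (p - b *: v); rewrite res => le_res.
have p_le : b * `|p| <= b * `|p - b *: v| + b ^+ 2 * `|v|.
  rewrite expr2 -mulrA -mulrDr ler_pM2l//.
  rewrite -[X in `|X| <= _](subrK (b *: v) p).
  by apply: le_trans (ler_normD _ _) _; rewrite normrZ gtr0_norm.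
have rhs_le : `|- (Ax - T e) + b *: (S v - T v) - b ^+ 2 *: v| <=
    L * `|e| ^+ 2 + b * (L * `|e| * `|v|) + b ^+ 2 * `|v|.
  apply: le_trans (ler_normB _ _) _; apply: lerD; last first.
    by rewrite normrZ ger0_norm// sqr_ge0.
  apply: le_trans (ler_normD _ _) _; rewrite normrN; apply: lerD => //.
  by rewrite normrZ gtr0_norm// ler_pM2l.
lra.
Qed.

(** [a / N] times the sum of the [p i] is [a] times their mean. Summing the
    component bounds costs a factor [N] on the quadratic term only, since the
    other terms carry the summable weights [`|v i|]. *)
Lemma newton_mean_le (R : realType) (X : normedModType R) (N : nat)
    (a L S : R) (e : X) (v p : 'I_N -> X) :
  (0 < N)%N -> 0 < a -> 0 <= L -> \sum_(i < N) `|v i| <= S ->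
  (forall i, a / N%:R * `|p i| <= L * `|e| ^+ 2
      + a / N%:R * (L * `|e| * `|v i|) + 2 * (a / N%:R) ^+ 2 * `|v i|) ->
  a * `|N%:R^-1 *: \sum_(i < N) p i| <=
    N%:R * L * `|e| ^+ 2 + a * L * `|e| * S + 2 * a ^+ 2 * S.
Proof.
move=> N0 a0 L0 vS p_le; set b := a / N%:R in p_le.
have N1 : 1 <= N%:R :> R by rewrite ler1n.
have N0' : 0 < N%:R :> R by rewrite ltr0n.
have b0 : 0 < b by rewrite divr_gt0.
have ba : b <= a by rewrite ler_pdivrMr// ler_peMr// ltW.
have S0 : 0 <= S by apply: le_trans vS; exact: sumr_ge0.
have -> : a * `|N%:R^-1 *: \sum_(i < N) p i| = b * `|\sum_(i < N) p i|.
  by rewrite normrZ ger0_norm ?invr_ge0// mulrA.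
have sum_le : b * `|\sum_(i < N) p i| <= N%:R * (L * `|e| ^+ 2)
    + (b * (L * `|e|) + 2 * b ^+ 2) * \sum_(i < N) `|v i|.
  apply: le_trans (_ : b * \sum_(i < N) `|p i| <= _).
    by rewrite ler_pM2l// ler_norm_sum.
  rewrite !mulr_sumr mulr_natl -[X in _ *+ X]card_ord -sumr_const -big_split /=.
  apply: ler_sum => i _; apply: le_trans (p_le i) _.
  by rewrite le_eqVlt (_ : _ == _)//; apply/eqP; ring.
apply: le_trans sum_le _.
rewrite -mulrA -addrA lerD2l.
apply: le_trans (_ : (b * (L * `|e|) + 2 * b ^+ 2) * S <= _).
  by rewrite ler_wpM2l// addr_ge0// !mulr_ge0// ?sqr_ge0// ltW.
rewrite -mulrDl ler_wpM2r// lerD//.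
  by rewrite -mulrA ler_wpM2r// mulr_ge0.
rewrite ler_pM2l// ler_sqr// nnegrE ltW//.
Qed.

(** [M] and [eps] are chosen so that the three contributions to [e'] (quadratic
    remainder, Lipschitz defect of the source term, source term) use at most a
    quarter each of the budget [M * a / rho], and [a / rho] is below the next
    parameter [a']. *)
Lemma rate_step (R : realType) (a a' rho M eps L N e e' : R) :
  0 < a -> 0 < rho -> a <= rho * a' -> 0 <= L -> 0 <= N -> 0 <= eps ->
  0 <= M -> 0 <= e -> e <= M * a ->
  4 * rho * N * L * M <= 1 -> 4 * rho * L * eps <= 1 -> 8 * rho * eps <= M ->
  a * e' <= N * L * e ^+ 2 + a * L * e * eps + 2 * a ^+ 2 * eps ->
  e' <= M * a'.
Proof.
move=> a0 rho0 aa' L0 N0 eps0 M0 e0 eM quad lin src step.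
have e2 : e ^+ 2 <= (M * a) ^+ 2 by rewrite ler_sqr// nnegrE mulr_ge0// ltW.
have h1 : N * L * e ^+ 2 <= N * L * (M * a) ^+ 2.
  by rewrite ler_wpM2l// mulr_ge0.
have h2 : a * L * e * eps <= a * L * (M * a) * eps.
  by rewrite ler_wpM2r// ler_wpM2l// mulr_ge0// ltW.
have q1 : 4 * rho * N * L * M * M <= M by rewrite ler_piMl.
have q2 : 4 * rho * L * eps * M <= M by rewrite ler_piMl.
have coef : rho * (N * L * M ^+ 2 + L * M * eps + 2 * eps) <= M by lra.
have step' : a * e' <= a * (a * (N * L * M ^+ 2 + L * M * eps + 2 * eps)).
  by lra.
rewrite ler_pM2l// in step'.
rewrite -(ler_pM2l rho0).
apply: le_trans (_ : a * M <= _); last first.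
  by rewrite mulrCA mulrC ler_wpM2l.
apply: le_trans (_ : rho * (a * (N * L * M ^+ 2 + L * M * eps + 2 * eps)) <= _).
  by rewrite ler_pM2l.
by rewrite mulrCA ler_pM2l.
Qed.

(** * Convergence *)

Theorem theorem1 (R : realType) (X : completeNormedModType R)
    (J : X -> {linear X -> R^o})
    (hJ : forall x : X, duality_map x = [set J x])
    (N : nat) (hN : (1 <= N)%N)
    (A : 'I_N -> X -> X)
    (hA : forall i : 'I_N, accretive J (A i))
    (xhat : X) (hsol : forall i : 'I_N, A i xhat = 0)
    (r : R) (hr : 0 < r)
    (hdiff : forall (i : 'I_N) (x : X),
      closed_ball xhat r x -> differentiable (A i) x)
    (K : R)
    (hLip : forall (i : 'I_N) (x y : X),
      closed_ball xhat r x -> closed_ball xhat r y ->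
      opnorm (fun h : X => 'd (A i) x h - 'd (A i) y h) <= K * `|x - y|)
    (alpha : nat -> R) (rho : R)
    (halpha_pos : forall n : nat, 0 < alpha n)
    (halpha_lim : alpha n @[n --> \oo] --> (0 : R))
    (hrho : 1 < rho)
    (halpha_ratio : forall n : nat, 1 <= alpha n / alpha n.+1 <= rho) :
  exists2 eps : R, 0 < eps &
    forall (v xi0 : 'I_N -> X) (x0 : X),
      (forall i : 'I_N, closed_ball xhat r (xi0 i)) ->
      (forall i : 'I_N, xi0 i - xhat = 'd (A i) xhat (v i)) ->
      \sum_(i < N) `|v i| <= eps ->
      `|x0 - xhat| <= eps ->
      exists (x : nat -> X) (y : nat -> 'I_N -> X),
        [/\ regularized_newton_iteration A alpha xi0 x0 x y,
            forall (x' : nat -> X) (y' : nat -> 'I_N -> X),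
              regularized_newton_iteration A alpha xi0 x0 x' y' ->
              x' =1 x /\ y' =2 y
          & exists C : R, forall n : nat, `|x n - xhat| <= C * alpha n].
Proof.
have ballP (x : X) : closed_ball xhat r x <-> `|x - xhat| <= r.
  exact: mem_closed_ball.
have N0 : 0 < N%:R :> R by rewrite ltr0n.
have rho0 : 0 < rho by apply: lt_trans hrho.
(* [K] may be zero or negative, but the constant must be divided by below. *)
pose L := Num.max K 1.
have L0 : 0 < L by rewrite /L lt_max ltr01 orbT.
have ball_hat : closed_ball xhat r xhat.
  by apply/ballP; rewrite subrr normr0 ltW.
have dlip i (x y h : X) : closed_ball xhat r x -> closed_ball xhat r y ->
    `|'d (A i) x h - 'd (A i) y h| <= L * `|x - y| * `|h|.
  move=> bx by_; apply: diff_lipschitz; [exact: hdiff|exact: hdiff|].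
  by apply: le_trans (hLip _ _ _ bx by_) _; rewrite ler_wpM2r// /L le_max lexx.
have taylor i (x : X) : closed_ball xhat r x ->
    `|A i x - 'd (A i) x (x - xhat)| <= L * `|x - xhat| ^+ 2.
  move=> bx; have xE : (x - xhat) + xhat = x by rewrite subrK.
  have seg (t : R) : 0 <= t <= 1 ->
      closed_ball xhat r (t *: (x - xhat) + xhat).
    move=> /andP[t0 t1]; apply/ballP; rewrite addrK normrZ ger0_norm//.
    by apply: le_trans ((ballP x).1 bx); rewrite ler_piMl.
  have := @norm_taylor1_le _ _ _ hJ (A i) xhat (x - xhat) L (ltW L0).
  rewrite xE hsol subr0; apply=> [t t01|t t01]; first exact/hdiff/seg.
  apply: le_trans (dlip _ _ _ _ (seg _ t01) bx) _.
  rewrite expr2 mulrA ler_wpM2r// ler_wpM2l ?(ltW L0)//.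
  move: t01 => /andP[t0 t1].
  rewrite -[X in _ - X]xE opprD addrACA subrr addr0.
  rewrite -[X in _ - X]scale1r -scalerBl normrZ ler_piMl// distrC.
  by rewrite ger0_norm ?subr_ge0//; lra.
have res_ge i (x : X) a (h : X) : closed_ball xhat r x -> 0 < a ->
    a * `|h| <= `|'d (A i) x h + a *: h|.
  move=> bx _; apply: (resolvent_ge hJ (T := 'd (A i) x)).
  exact: (accretive_diff hJ _ (hA i) (hdiff _ _ bx)).
have b_gt0 n : 0 < alpha n / N%:R by rewrite divr_gt0.
have alpha_le n : alpha n <= alpha 0.
  elim: n => // n; apply: le_trans.
  by have /andP[+ _] := halpha_ratio n; rewrite ler_pdivlMr// mul1r.
have alphaS n : alpha n <= rho * alpha n.+1.
  by have /andP[_] := halpha_ratio n; rewrite ler_pdivrMr.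
(* The first bound on [M] keeps the iterates in the ball, the second is the
   smallness that [rate_step] asks for. *)
pose M := Num.min (r / alpha 0) (4 * rho * N%:R * L)^-1.
have M0 : 0 < M by rewrite lt_min divr_gt0//= invr_gt0 !mulr_gt0.
have ball_M n (x : X) : `|x - xhat| <= M * alpha n -> closed_ball xhat r x.
  move=> xM; apply/ballP; apply: le_trans xM _.
  rewrite -ler_pdivlMr//.
  apply: le_trans (_ : r / alpha 0 <= _); first by rewrite /M ge_min lexx.
  by rewrite ler_wpM2l ?(ltW hr)// lef_pV2// posrE.
pose eps := Num.min (M * alpha 0) (Num.min (4 * rho * L)^-1 (M / (8 * rho))).
have eps0 : 0 < eps.
  by rewrite !lt_min mulr_gt0 //= invr_gt0 divr_gt0 ?mulr_gt0.
exists eps => // v xi0 x0 _ source v_small x0_small.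
pose newton_eq n (x : X) (y : 'I_N -> X) := forall i,
  A i x + (alpha n / N%:R) *: (x - xi0 i)
    + ('d (A i) x (y i - x) + (alpha n / N%:R) *: (y i - x)) = 0.
(* Solvability is known in the ball only; the guard still yields a total choice
   function, which the recursion needs. *)
have newton_ex n (x : X) : exists y, closed_ball xhat r x -> newton_eq n x y.
  have [bx|nbx] := pselect (closed_ball xhat r x); last by exists (fun=> 0).
  have /choice[h hE] : forall i, exists h,
      'd (A i) x h + (alpha n / N%:R) *: h =
      - (A i x + (alpha n / N%:R) *: (x - xi0 i)).
    move=> i; apply: resolvent_surjective => //.
      exact/diff_continuous/hdiff.
    by move=> a h; exact: res_ge.
  by exists (fun i => h i + x) => _ i; rewrite addrK hE subrr.
have newton_unique n (x : X) y y' : closed_ball xhat r x ->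
    newton_eq n x y -> newton_eq n x y' -> y =1 y'.
  move=> bx yE y'E i; have := res_ge i x _ (y i - y' i) bx (b_gt0 n).
  have -> : 'd (A i) x (y i - y' i) + (alpha n / N%:R) *: (y i - y' i) = 0.
    have -> : y i - y' i = (y i - x) - (y' i - x) by rewrite opprB addrA subrK.
    rewrite linearB scalerBr addrACA -opprD.
    by rewrite -(addr0_eq (yE i)) -(addr0_eq (y'E i)) subrr.
  by rewrite normr0 pmulr_rle0// normr_le0 subr_eq0 => /eqP.
have newton_rate n (x : X) y : `|x - xhat| <= M * alpha n -> newton_eq n x y ->
    `|N%:R^-1 *: \sum_(i < N) y i - xhat| <= M * alpha n.+1.
  move=> xM yE; have bx := ball_M _ _ xM.
  have meanE : N%:R^-1 *: \sum_(i < N) y i - xhat =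
      N%:R^-1 *: \sum_(i < N) (y i - xhat).
    rewrite sumrB sumr_const card_ord scalerBr -[xhat *+ N]scaler_nat scalerA.
    by rewrite mulVf ?scale1r// gt_eqF.
  apply: (@rate_step R (alpha n) _ rho M eps L N%:R `|x - xhat|) => //.
  - exact: ltW.
  - exact: ltW.
  - exact: ltW.
  - by rewrite -ler_pdivlMl ?mulr_gt0// mulr1 /M ge_min lexx orbT.
  - by rewrite -ler_pdivlMl ?mulr_gt0// mulr1 /eps !ge_min lexx !orbT.
  - by rewrite -ler_pdivlMl ?mulr_gt0// mulrC /eps !ge_min lexx !orbT.
  rewrite meanE; apply: (newton_mean_le hN _ _ v_small) => //; first exact: ltW.
  move=> i.
  apply: (@newton_step_le _ _ ('d (A i) x) ('d (A i) xhat) _ _ _ (A i x)) => //.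
  - by move=> h; exact: res_ge.
  - exact: taylor.
  - by rewrite [`|x - _|]distrC; exact: dlip.
  have e1 : y i - xhat - (x - xhat) = y i - x by rewrite opprB addrA subrK.
  have e2 : x - xhat - (xi0 i - xhat) = x - xi0 i by rewrite opprB addrA subrK.
  by rewrite e1 -source e2 yE.
have [F FE] := choice (fun nx : nat * X => newton_ex nx.1 nx.2).
pose x := fix x n :=
  if n is m.+1 then N%:R^-1 *: \sum_(i < N) F (m, x m) i else x0.
have x_rate n : `|x n - xhat| <= M * alpha n.
  elim: n => [|n IH].
    by apply: le_trans x0_small _; rewrite /eps ge_min lexx.
  exact: newton_rate IH (FE (n, x n) (ball_M _ _ IH)).
have x_ball n := ball_M _ _ (x_rate n).
exists x, (fun n => F (n, x n)); split; last by exists M.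
- split=> // n; split=> //; first by move=> i; exact: hdiff.
  exact: (FE (n, x n) (x_ball n)).
- move=> x' y' [x'0 x'S].
  have xx' : x' =1 x.
    elim=> [|n IH] //; have [_ yE ->] := x'S n; rewrite /=.
    congr (_ *: _); apply: eq_bigr => i _.
    apply: (@newton_unique n (x n)) => //; last exact: (FE (n, x n) (x_ball n)).
    by rewrite -IH.
  split=> // n; have [_ yE _] := x'S n.
  apply: (@newton_unique n (x n)) => //; last exact: (FE (n, x n) (x_ball n)).
  by rewrite -xx'.
Qed.
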